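(* Let $n,m\ge 1$ be integers, let $\alpha_1,\dots,\alpha_m>0$ and $\alpha=\alpha_1+\cdots+\alpha_m$. If $$\mathcal{A}^h_m:=\frac{1}{\Omega_Q^m}\int_{|(y_1,\dots,y_m)|_h<1}\prod_{i=1}^m|y_i|_h^{-\alpha_i}\,dy_1\cdots dy_m<\infty,$$ then the $m$-linear Hardy operator $$\mathfrak{H}^h_m(f_1,\dots,f_m)(x)=\frac{1}{\Omega_Q^m|x|_h^{mQ}}\int_{|(y_1,\dots,y_m)|_h<|x|_h}f_1(y_1)\cdots f_m(y_m)\,dy_1\cdots dy_m,\qquad x\in\mathbb{H}^n\setminus\{0\},$$ is bounded from $H^\infty_{\alpha_1}(\mathbb{H}^n)\times\cdots\times H^\infty_{\alpha_m}(\mathbb{H}^n)$ to $H^\infty_\alpha(\mathbb{H}^n)$, and $$\|\mathfrak{H}^h_m\|_{\prod_{i=1}^m H^\infty_{\alpha_i}(\mathbb{H}^n)\to H^\infty_\alpha(\mathbb{H}^n)}=\mathcal{A}^h_m .$$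
   Context: The Heisenberg group $\mathbb{H}^n$ is $\mathbb{R}^{2n}\times\mathbb{R}$ with group law $x\circ y=\big(x_1+y_1,\dots,x_{2n}+y_{2n},\,x_{2n+1}+y_{2n+1}+2\sum_{j=1}^n(y_jx_{n+j}-x_jy_{n+j})\big)$ and dilations $\delta_r(x_1,\dots,x_{2n},x_{2n+1})=(rx_1,\dots,rx_{2n},r^2x_{2n+1})$, $r>0$. Its Haar measure $dx$ is Lebesgue measure on $\mathbb{R}^{2n+1}$, and $|\delta_r(E)|=r^Q|E|$ with $Q=2n+2$. The norm is $|x|_h=\big[(\sum_{i=1}^{2n}x_i^2)^2+x_{2n+1}^2\big]^{1/4}$, and for $(y_1,\dots,y_m)\in(\mathbb{H}^n)^m$ we put $|(y_1,\dots,y_m)|_h=\big(\sum_{i=1}^m|y_i|_h^2\big)^{1/2}$. $\Omega_Q=|B(0,1)|$ is the Lebesgue measure of the unit ball $\{y\in\mathbb{H}^n:|y|_h<1\}$. For $\alpha>0$, $H^\infty_\alpha(\mathbb{H}^n)$ is the space of measurable functions $f$ on $\mathbb{H}^n$ (modulo equality a.e.) with $\|f\|_{H^\infty_\alpha(\mathbb{H}^n)}:=\operatorname{ess\,sup}_{x\in\mathbb{H}^n}|x|_h^\alpha|f(x)|<\infty$. An $m$-linear integral operator $T$ is bounded from $\prod_{i}H^\infty_{\alpha_i}(\mathbb{H}^n)$ to $H^\infty_\alpha(\mathbb{H}^n)$ if for all $f_i\in H^\infty_{\alpha_i}(\mathbb{H}^n)$ the defining integral converges absolutely for a.e. $x$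 and $\|T(f_1,\dots,f_m)\|_{H^\infty_\alpha}\le C\prod_i\|f_i\|_{H^\infty_{\alpha_i}}$ for some constant $C<\infty$ independent of the $f_i$; the operator norm is the least such $C$. *)

(* Defs.v *)
From HB Require Import structures.
From mathcomp Require Import all_boot all_order all_algebra.
From mathcomp Require Import all_classical all_reals all_analysis.
From mathcomp Require Import ess_sup_inf.
Set Implicit Arguments.
Unset Strict Implicit.
Unset Printing Implicit Defensive.
Import Order.TTheory GRing.Theory Num.Theory.
Import numFieldNormedType.Exports.
Local Open Scope classical_set_scope.
Local Open Scope ring_scope.

(* The library has the product sigma-algebra on n.-tuple T but no product
   measure on it; it is built here from the binary product measure, along
   T * n.-tuple T -> n.+1.-tuple T. Its values on boxes are in
   tuple_measure_box. *)
Section tuple_measure.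
Context d (T : measurableType d) (R : realType).
Variable mu : {sigma_finite_measure set T -> \bar R}.

Definition pair_cons n (p : T * n.-tuple T) : n.+1.-tuple T :=
  [tuple of p.1 :: p.2].

Lemma measurable_pair_cons n : measurable_fun setT (@pair_cons n).
Proof. exact: (measurable_cons measurable_fst measurable_snd). Qed.

Section cons_measure.
Variables (n : nat) (nu : {sigma_finite_measure set (n.-tuple T) -> \bar R}).

Definition cons_measure : set (n.+1.-tuple T) -> \bar R :=
  pushforward (mu \x nu)%E (@pair_cons n).

Let cons_measureE : {m : {measure set (n.+1.-tuple T) -> \bar R} |
  m = cons_measure :> (set _ -> _)}.
Proof.
by exists (measure_function_pushforward__canonical__measure_function_Measure
  (mu \x nu)%E (@measurable_pair_cons n)).
Qed.

Let cons_measure0 : cons_measure set0 = 0%E.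
Proof. by have [m <-] := cons_measureE; exact: measure0. Qed.

Let cons_measure_ge0 A : (0 <= cons_measure A)%E.
Proof. by have [m <-] := cons_measureE; exact: measure_ge0. Qed.

Let cons_measure_semi_sigma_additive : semi_sigma_additive cons_measure.
Proof.
by have [m <-] := cons_measureE; exact: measure_semi_sigma_additive.
Qed.

HB.instance Definition _ := isMeasure.Build _ _ _ cons_measure
  cons_measure0 cons_measure_ge0 cons_measure_semi_sigma_additive.

Lemma cons_measure_box (A : set T) (B : set (n.-tuple T)) :
  measurable A -> measurable B ->
  cons_measure [set t | A (thead t) /\ B [tuple of behead t]]
  = (mu A * nu B)%E.
Proof.
move=> mA mB; rewrite -product_measure1E// /cons_measure /pushforward.
congr (product_measure1 _ _ _); have tK p : [tuple of behead (@pair_cons n p)] = p.2 by exact/val_inj.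
by apply/seteqP; split=> p /=; rewrite tK.
Qed.

Lemma measurable_cons_box (A : set T) (B : set (n.-tuple T)) :
  measurable A -> measurable B ->
  measurable [set t : n.+1.-tuple T | A (thead t) /\ B [tuple of behead t]].
Proof.
move=> mA mB; apply: measurableI.
- by rewrite -[X in measurable X]setTI; exact: measurable_tnth.
- by rewrite -[X in measurable X]setTI; exact: measurable_behead.
Qed.

Let cons_measure_sigma_finite : sigma_finite setT cons_measure.
Proof.
have /sigma_finiteP[F [TF ndF Foo]] := sigma_finiteT mu.
have /sigma_finiteP[G [TG ndG Goo]] := sigma_finiteT nu.
exists (fun k => [set t | F k (thead t) /\ G k [tuple of behead t]]).
  apply/seteqP; split=> // t _.
  have [i _ Fi] : (\bigcup_i F i) (thead t) by rewrite -TF.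
  have [j _ Gj] : (\bigcup_i G i) [tuple of behead t] by rewrite -TG.
  exists (maxn i j) => //; split.
  - by move: Fi; exact/subsetPset/ndF/leq_maxl.
  - by move: Gj; exact/subsetPset/ndG/leq_maxr.
move=> k; have [mF Fk] := Foo k; have [mG Gk] := Goo k.
split; first exact: measurable_cons_box.
by rewrite cons_measure_box// lte_mul_pinfty// ge0_fin_numE.
Qed.

HB.instance Definition _ := Measure_isSigmaFinite.Build _ _ _ cons_measure
  cons_measure_sigma_finite.

End cons_measure.

Fixpoint tuple_measure n : {sigma_finite_measure set (n.-tuple T) -> \bar R} :=
  match n with
  | 0 => \d_([tuple] : 0.-tuple T)
  | k.+1 => cons_measure (tuple_measure k)
  end.

Lemma tuple_measure_box n (A : 'I_n -> set T) :
  (forall i, measurable (A i)) ->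
  tuple_measure n [set t | forall i, A i (tnth t i)]
  = (\prod_(i < n) mu (A i))%E.
Proof.
elim: n A => [|n IH] A mA.
  by rewrite big_ord0 /= diracE mem_set//= => -[].
have mB : measurable [set t : n.-tuple T | forall i, A (lift ord0 i) (tnth t i)].
  rewrite (_ : [set _ | _] = \bigcap_(i in [set: 'I_n])
     ((fun t : n.-tuple T => tnth t i) @^-1` A (lift ord0 i))); last first.
    by apply/seteqP; split => t /= h i; [move=> _; exact: h|exact: (h i)].
  apply: fin_bigcap_measurable => // i _.
  by rewrite -[X in measurable X]setTI; exact: measurable_tnth.
rewrite big_ord_recl -IH// -cons_measure_box//; congr (cons_measure _ _).
apply/seteqP; split => t /=.
  move=> At; split; first exact: (At ord0).
  by move=> i; have := At (lift ord0 i); rewrite [X in tnth X _]tuple_eta tnthS.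
move=> [A0 At] i; case: (unliftP ord0 i) => [j ->|->//].
by rewrite [X in tnth X _]tuple_eta tnthS; exact: At.
Qed.

End tuple_measure.

Section heisenberg.
Variable R : realType.

(* H^n as a set is R^(2n+1). Indices start at 0: the first n + n coordinates
   are the horizontal ones, the last one (ord_max) is the central one. *)
Definition heis (n : nat) := (n + n).+1.-tuple (measurableTypeR R).

Definition hcoord n (x : heis n) (i : 'I_(n + n)) : R :=
  tnth x (lift ord_max i).

Definition vcoord n (x : heis n) : R := tnth x ord_max.

Definition heis_pt n (u : 'I_(n + n) -> R) (t : R) : heis n :=
  [tuple oapp u t (unlift ord_max i) | i < (n + n).+1].

Lemma hcoord_pt n u t i : hcoord (heis_pt u t : heis n) i = u i.
Proof. by rewrite /hcoord tnth_mktuple liftK. Qed.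

Lemma vcoord_pt n u t : vcoord (heis_pt u t : heis n) = t.
Proof. by rewrite /vcoord tnth_mktuple unlift_none. Qed.

Definition heis_mul n (x y : heis n) : heis n :=
  heis_pt (fun i => hcoord x i + hcoord y i)
    (vcoord x + vcoord y +
     2 * \sum_(j < n) (hcoord y (lshift n j) * hcoord x (rshift n j) -
                       hcoord x (lshift n j) * hcoord y (rshift n j))).

Definition heis_dil n (r : R) (x : heis n) : heis n :=
  heis_pt (fun i => r * hcoord x i) (r ^+ 2 * vcoord x).

(* The homogeneous dimension Q. *)
Definition hdim (n : nat) : nat := n.*2.+2.

Definition hnorm n (x : heis n) : R :=
  ((\sum_(i < n + n) hcoord x i ^+ 2) ^+ 2 + vcoord x ^+ 2) `^ 4^-1.

Lemma hnorm_dil n (r : R) (x : heis n) :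
  0 <= r -> hnorm (heis_dil r x) = r * hnorm x.
Proof.
move=> r0; rewrite /hnorm vcoord_pt.
under eq_bigr do rewrite hcoord_pt exprMn.
rewrite -mulr_sumr !exprMn -mulrDr -exprD powRM ?exprn_ge0//; last first.
  by rewrite addr_ge0// sqr_ge0.
by rewrite -(powR_mulrn (2 + 2) r0) -powRrM mulfV ?powRr1// pnatr_eq0.
Qed.

(* Lebesgue measure on R^(2n+1), which is the Haar measure of heis_mul. *)
Definition haar (n : nat) : {sigma_finite_measure set (heis n) -> \bar R} :=
  tuple_measure (@lebesgue_measure R) (n + n).+1.

Definition hball_vol n : R := fine (haar n [set y | hnorm y < 1]).

Definition mheis (m n : nat) := m.-tuple (heis n).

Definition mhaar m n : {sigma_finite_measure set (mheis m n) -> \bar R} :=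
  tuple_measure (haar n) m.

Definition mhnorm m n (y : mheis m n) : R :=
  Num.sqrt (\sum_(i < m) hnorm (tnth y i) ^+ 2).

Definition Hinfty_norm n (a : R) (f : heis n -> R) : \bar R :=
  ess_sup (haar n) (fun x => (hnorm x `^ a * `|f x|)%:E).

(* Elements of H^oo_a are handled through their Borel representatives: every
   Lebesgue measurable function is a.e. equal to a Borel one. *)
Definition Hinfty n (a : R) : set (heis n -> R) :=
  [set f | measurable_fun setT f /\ (Hinfty_norm a f < +oo)%E].

(* T is an m-linear integral operator and cv f x says that the integral
   defining T f at x converges absolutely. The predicate says that T maps
   \prod_i H^oo_(al i) to H^oo_be with constant C. *)
Definition Hinfty_bound m n (al : 'I_m -> R) (be : R)
    (cv : ('I_m -> heis n -> R) -> heis n -> Prop)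
    (T : ('I_m -> heis n -> R) -> heis n -> R) (C : R) : Prop :=
  forall f : 'I_m -> heis n -> R, (forall i, Hinfty (al i) (f i)) ->
  [/\ {ae haar n, forall x, cv f x},
      measurable_fun setT (T f) &
      (Hinfty_norm be (T f) <= C%:E * \prod_(i < m) Hinfty_norm (al i) (f i))%E].

Definition Hinfty_bounded m n (al : 'I_m -> R) (be : R)
    (cv : ('I_m -> heis n -> R) -> heis n -> Prop)
    (T : ('I_m -> heis n -> R) -> heis n -> R) : Prop :=
  exists C : R, Hinfty_bound al be cv T C.

Definition Hinfty_opnorm m n (al : 'I_m -> R) (be : R)
    (cv : ('I_m -> heis n -> R) -> heis n -> Prop)
    (T : ('I_m -> heis n -> R) -> heis n -> R) : \bar R :=
  ereal_inf [set C%:E | C in Hinfty_bound al be cv T].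

Definition tensor m n (f : 'I_m -> heis n -> R) (y : mheis m n) : R :=
  \prod_(i < m) f i (tnth y i).

(* At x = 0, outside the domain of the operator, the value is 0. *)
Definition hardy m n (f : 'I_m -> heis n -> R) (x : heis n) : R :=
  (hball_vol n ^+ m * hnorm x ^+ (m * hdim n))^-1 *
  \int[mhaar m n]_(y in [set y | mhnorm y < hnorm x]) tensor f y.

Definition hardy_cv m n (f : 'I_m -> heis n -> R) (x : heis n) : Prop :=
  (mhaar m n).-integrable [set y | mhnorm y < hnorm x] (EFin \o tensor f).

(* 0 `^ (- a) is 0 rather than +oo for a > 0; this changes the integrand only on
   the null set of the y having some y_i = 0. *)
Definition hardy_const m n (al : 'I_m -> R) : \bar R :=
  (((hball_vol n ^+ m)^-1)%:E *
   \int[mhaar m n]_(y in [set y | (mhnorm y < 1)%R])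
     (\prod_(i < m) hnorm (tnth y i) `^ (- al i))%:E)%E.

End heisenberg.

(* Main.v *)
(** If [f_i] has norm [N_i], then [|f_i(y)| <= N_i |y|^-al_i] almost everywhere,
    so on the ball of radius [r = |x|] the integrand is dominated by the
    homogeneous weight [\prod_i N_i |y_i|^-al_i]. The dilation [delta_r]
    multiplies Haar measure by [r^Q], hence the integral of [\prod_i |y_i|^-al_i]
    over the ball of radius [r] is [r^(mQ - \sum_i al_i)] times the one over the
    unit ball, which gives the upper bound. For [f_i(y) = |y|^-al_i], of norm 1,
    all these inequalities are equalities. *)
Require Import Defs.
From mathcomp Require Import all_boot all_order all_algebra.
From mathcomp Require Import all_classical all_reals all_analysis.
From mathcomp Require Import measurable_realfun ess_sup_inf ring lra.
Set Implicit Arguments.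
Unset Strict Implicit.
Unset Printing Implicit Defensive.
Import Order.TTheory GRing.Theory Num.Theory.
Import numFieldNormedType.Exports.
Local Open Scope classical_set_scope.
Local Open Scope ring_scope.

(** * Change of variables for scalings of the line *)

(** [c] is the inverse Jacobian of [phi]. Stating the formula on nonnegative integrands, rather than
    on sets, lets Tonelli carry it to products. *)
Definition dilates d (T : measurableType d) (R : realType)
    (mu : {measure set T -> \bar R}) (phi : T -> T) (c : R) :=
  forall F : T -> \bar R, measurable_fun setT F -> (forall x, 0 <= F x)%E ->
  (\int[mu]_x F (phi x) = c%:E * \int[mu]_x F x)%E.

(** The pushforward of Lebesgue measure under scaling by [r], multiplied by [r], agrees with
    Lebesgue measure on half-open intervals, hence everywhere by uniqueness. *)
Lemma lebesgue_dilates (R : realType) (r : R) : 0 < r ->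
  dilates (@lebesgue_measure R)
    (fun x : measurableTypeR R => r * x : measurableTypeR R) r^-1.
Proof.
move=> r0 F mF F0.
pose sc (x : measurableTypeR R) : measurableTypeR R := r * x.
have mr : measurable_fun setT sc.
  exact: mulrl_measurable.
have muE A : measurable A -> lebesgue_measure A =
    mscale (NngNum (ltW r0)) (pushforward (@lebesgue_measure R) sc) A.
  apply: lebesgue_measure_unique => X [[a b] _ <-].
  have preE : sc @^-1` `]a, b] = `](r^-1 * a), (r^-1 * b)]%classic.
    by apply/seteqP; split => x /=; rewrite !in_itv/= ltr_pdivrMl// ler_pdivlMl.
  transitivity (r%:E * lebesgue_measure
      (`](r^-1 * a)%R, (r^-1 * b)%R]%classic : set R))%E; last first.
    rewrite /mscale/= /pushforward.
    by congr (_ * lebesgue_measure _)%E; rewrite -preE.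
  have -> := lebesgue_measure_itv `]a, b].
  have -> := lebesgue_measure_itv `](r^-1 * a), (r^-1 * b)].
  rewrite /= !lte_fin ltr_pM2l ?invr_gt0//.
  case: ifPn => _; last by rewrite mule0.
  by rewrite -!EFinD -EFinM mulrBr !mulVKf ?gt_eqF.
(* The measure structure on the pushforward depends on a proof that [sc] is measurable; [m] is that
   proof, left as an implicit premise of the statement. *)
have intE : (\int[lebesgue_measure]_x F x = \int[mscale (NngNum (ltW r0))
   (pushforward (@lebesgue_measure R) sc)]_x F x)%E.
  by move=> m; apply: eq_measure_integral => A mA _; exact: (muE m).
rewrite (intE mr) ge0_integral_mscale//= muleA -EFinM mulVf ?gt_eqF// mul1e.
by rewrite (ge0_integral_pushforward mr).
Qed.

(** * Tonelli, coordinatewise dilations and null sets for measures on tuples *)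

Section tuple_measure_theory.
Context d (T : measurableType d) (R : realType).
Variable mu : {sigma_finite_measure set T -> \bar R}.

Lemma integral_cons_measure n
    (nu : {sigma_finite_measure set (n.-tuple T) -> \bar R})
    (F : n.+1.-tuple T -> \bar R) :
  measurable_fun setT F -> (forall x, 0 <= F x)%E ->
  (\int[cons_measure mu nu]_t F t = \int[mu]_x \int[nu]_t F [tuple of x :: t])%E.
Proof.
move=> mF F0.
transitivity (\int[pushforward (mu \x nu)%E (@pair_cons _ T n)]_t F t)%E.
  by apply: eq_measure_integral; first exact: measurable_pair_cons.
rewrite ge0_integral_pushforward//; last exact: measurable_pair_cons.
rewrite preimage_setT fubini_tonelli1//; last by move=> x; exact: F0.
by apply: measurableT_comp => //; exact: measurable_pair_cons.
Qed.

Lemma measurable_tuple_map n (phi : 'I_n -> T -> T) :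
  (forall i, measurable_fun setT (phi i)) ->
  measurable_fun setT (fun t : n.-tuple T => [tuple phi i (tnth t i) | i < n]).
Proof.
move=> mphi; apply/measurable_fun_tnthP => i.
rewrite (_ : _ \o _ = fun t : n.-tuple T => phi i (tnth t i)).
  by apply: measurableT_comp => //; exact: measurable_tnth.
by apply/funext => t /=; rewrite tnth_mktuple.
Qed.

(** Induction on the length by Tonelli, the Jacobians multiplying. It serves at two levels: the real
    coordinates of a point, and the components of a tuple of points. *)
Lemma tuple_measure_dilates n (phi : 'I_n -> T -> T) (c : 'I_n -> R) :
  (forall i, measurable_fun setT (phi i)) -> (forall i, 0 <= c i) ->
  (forall i, dilates mu (phi i) (c i)) ->
  dilates (tuple_measure mu n)
    (fun t => [tuple phi i (tnth t i) | i < n]) (\prod_(i < n) c i).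
Proof.
elim: n phi c => [|n IH] phi c mphi c0 dphi F mF F0.
  rewrite big_ord0 mul1e; apply: eq_integral => t _.
  by congr F; apply/eq_from_tnth => -[].
have mcons (x : T) : measurable_fun setT (fun t : n.-tuple T => [tuple of x :: t]).
  apply: (@measurable_cons _ _ _ _ (cst x) n id) => //; exact: measurable_cst.
rewrite /= !integral_cons_measure//; last first.
  by apply: measurableT_comp => //; exact: measurable_tuple_map.
rewrite big_ord_recl EFinM -muleA.
(* The integral over the tail, as a function of the head: the induction hypothesis rescales the tail
   for a fixed head, then [dphi ord0] rescales the head in [G]. *)
pose G x := (\int[tuple_measure mu n]_t F [tuple of x :: t])%E.
have mG : measurable_fun setT G.
  apply: (measurable_fun_fubini_tonelli_F (m2 := tuple_measure mu n)
    (F \o @pair_cons _ T n)); last by move=> x; exact: F0.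
  by apply: measurableT_comp => //; exact: measurable_pair_cons.
have G0 x : (0 <= G x)%E by exact: integral_ge0.
pose C := \prod_(i < n) c (lift ord0 i).
have C0 : 0 <= C by exact: prodr_ge0.
transitivity (\int[mu]_x (C%:E * G (phi ord0 x)))%E.
  apply: eq_integral => x _.
  transitivity (\int[tuple_measure mu n]_t F [tuple of phi ord0 x ::
      [tuple (phi \o lift ord0) i (tnth t i) | i < n]])%E; last first.
    apply: (IH (phi \o lift ord0) (c \o lift ord0) (fun i => mphi _)
      (fun i => c0 _) (fun i => dphi _)
      (fun t : n.-tuple T => F [tuple of phi ord0 x :: t]) _ (fun t => F0 _)).
    exact: (measurableT_comp mF).
  apply: eq_integral => t _.
  congr F; apply/eq_from_tnth => i; rewrite tnth_mktuple.
  by case: (unliftP ord0 i) => [j ->|->] ; rewrite ?tnthS ?tnth0 ?tnth_mktuple.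
rewrite ge0_integralZl//; last by apply: measurableT_comp.
by rewrite dphi// muleCA.
Qed.

(** The cylinder over a null set is a box with one side of measure 0, and this factor annihilates
    the product even when other sides have infinite measure. *)
Lemma tuple_measure_null_tnth n (N : set T) (i : 'I_n) :
  mu.-negligible N -> (tuple_measure mu n).-negligible [set t | N (tnth t i)].
Proof.
move=> [M [mM M0 NM]].
exists [set t : n.-tuple T | M (tnth t i)]; split.
- by rewrite -[X in measurable X]setTI; exact: measurable_tnth.
- pose A j := if j == i then M else setT.
  rewrite (_ : [set _ | _] = [set t : n.-tuple T | forall j, A j (tnth t j)]).
    rewrite tuple_measure_box => [|j]; last by rewrite /A; case: ifP.
    by rewrite (bigD1 i)//= {1}/A eqxx M0 mul0e.
  apply/seteqP; split => t /=.
    by move=> Mt j; rewrite /A; case: eqP => [->|].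
  by move=> /(_ i); rewrite /A eqxx.
- by move=> t /= Nt; exact: NM.
Qed.

End tuple_measure_theory.

(** * Measurability, scaling and the unit ball in the Heisenberg group *)

Section heisenberg_theory.
Variable R : realType.

Lemma hnorm_ge0 n (x : heis R n) : 0 <= hnorm x.
Proof. exact: powR_ge0. Qed.

Lemma hnorm_eq0_vcoord n (x : heis R n) : hnorm x = 0 -> vcoord x = 0.
Proof.
move=> /powR_eq0_eq0 /eqP; rewrite paddr_eq0 ?sqr_ge0// => /andP[_].
by rewrite sqrf_eq0 => /eqP.
Qed.

Lemma measurable_hnorm n : measurable_fun setT (@hnorm R n).
Proof.
rewrite /hnorm; apply: (measurableT_comp (measurable_powR 4^-1)).
apply: measurable_funD; apply: measurable_funX; last exact: measurable_tnth.
by apply: measurable_sum => i; apply: measurable_funX; exact: measurable_tnth.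
Qed.

Lemma measurable_mhnorm m n : measurable_fun setT (@mhnorm R m n).
Proof.
rewrite (_ : @mhnorm R m n =
    fun y => (\sum_(i < m) hnorm (tnth y i) ^+ 2) `^ 2^-1); last first.
  by apply/funext => y; rewrite powR12_sqrt// sumr_ge0// => i _; exact: sqr_ge0.
apply: (measurableT_comp (measurable_powR 2^-1)).
apply: measurable_sum => i; apply: measurable_funX.
by apply: measurableT_comp; [exact: measurable_hnorm|exact: measurable_tnth].
Qed.

Lemma measurable_mball m n (r : R) : measurable [set y : mheis R m n | mhnorm y < r].
Proof.
rewrite -[X in measurable X]setTI.
rewrite (_ : [set y | _] = @mhnorm R m n @^-1` `]-oo, r[); last first.
  by apply/seteqP; split => y /=; rewrite in_itv.
exact: measurable_mhnorm.
Qed.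

Lemma measurable_hball n (r : R) : measurable [set y : heis R n | hnorm y < r].
Proof.
rewrite -[X in measurable X]setTI.
rewrite (_ : [set y | _] = @hnorm R n @^-1` `]-oo, r[); last first.
  by apply/seteqP; split => y /=; rewrite in_itv.
exact: measurable_hnorm.
Qed.

Lemma measurable_tensor m n (f : 'I_m -> heis R n -> R) :
  (forall i, measurable_fun setT (f i)) -> measurable_fun setT (tensor f).
Proof.
move=> mf; apply: measurable_prod => i _.
by apply: measurableT_comp => //; exact: measurable_tnth.
Qed.

(** A dilation acts on each coordinate separately, the form that [tuple_measure_dilates] handles. *)
Lemma heis_dilE n (r : R) (x : heis R n) : heis_dil r x =
  [tuple (if unlift ord_max i is Some _ then r else r ^+ 2) * tnth x i
    | i < (n + n).+1].
Proof.
apply/eq_from_tnth => i; rewrite !tnth_mktuple.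
by case: unliftP => [j ->|->].
Qed.

Lemma haar_dilates n (r : R) : 0 < r ->
  dilates (haar R n) (heis_dil r) (r ^- hdim n).
Proof.
move=> r0 F mF F0.
pose c (i : 'I_(n + n).+1) := if unlift ord_max i is Some _ then r else r ^+ 2.
have c0 i : 0 < c i by rewrite /c; case: unlift => *; rewrite ?exprn_gt0.
have -> : r ^- hdim n = \prod_(i < (n + n).+1) (c i)^-1.
  (* The last factor is the central one, [r ^- 2]; the other [n + n] are [r^-1], so the exponents
     add up to [hdim n]. *)
  rewrite big_ord_recr/= /c unlift_none.
  under eq_bigr => i _.
    rewrite (_ : widen_ord _ i = lift ord_max i); last first.
      by apply/val_inj; rewrite /= /bump leqNgt ltn_ord.
    rewrite liftK; over.
  by rewrite prodr_const card_ord addnn -exprVn -exprVn -exprD addn2.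
under eq_integral do rewrite heis_dilE.
refine (@tuple_measure_dilates _ (measurableTypeR R) R (@lebesgue_measure R) _
  (fun i (x : measurableTypeR R) => c i * x : measurableTypeR R)
  (fun i => (c i)^-1) _ _ _ F mF F0) => i.
- exact: mulrl_measurable.
- by rewrite invr_ge0 ltW.
- exact: lebesgue_dilates.
Qed.

Lemma measurable_heis_dil n (r : R) : measurable_fun setT (@heis_dil R n r).
Proof.
rewrite (_ : @heis_dil R n r = fun x => [tuple (if unlift ord_max i is Some _
    then r else r ^+ 2) * tnth x i | i < (n + n).+1]); last first.
  by apply/funext => x; rewrite heis_dilE.
apply: (@measurable_tuple_map _ (measurableTypeR R) _
  (fun i (x : measurableTypeR R) => _ * x : measurableTypeR R)) => i.
exact: mulrl_measurable.
Qed.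

Definition mheis_dil m n (r : R) (y : mheis R m n) : mheis R m n :=
  [tuple heis_dil r (tnth y i) | i < m].

Lemma mhaar_dilates m n (r : R) : 0 < r ->
  dilates (mhaar R m n) (mheis_dil r) (r ^- (m * hdim n)).
Proof.
move=> r0; have -> : r ^- (m * hdim n) = \prod_(i < m) r ^- hdim n.
  by rewrite prodr_const card_ord exprVn -exprM mulnC.
apply: (@tuple_measure_dilates _ (heis R n) R (haar R n) m (fun=> heis_dil r)
  (fun=> r ^- hdim n)) => // i.
- exact: measurable_heis_dil.
- by rewrite invr_ge0 exprn_ge0 ?ltW.
- exact: haar_dilates.
Qed.

Lemma mhnorm_dil m n (r : R) (y : mheis R m n) : 0 <= r ->
  mhnorm (mheis_dil r y) = r * mhnorm y.
Proof.
move=> r0; rewrite /mhnorm -[in RHS](ger0_norm r0) -sqrtr_sqr -sqrtrM ?sqr_ge0//.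
rewrite mulr_sumr; congr Num.sqrt; apply: eq_bigr => i _.
by rewrite tnth_mktuple hnorm_dil// exprMn.
Qed.

(** A vanishing norm forces the central coordinate to vanish, which confines the set to a null
    hyperplane. Off this set, powers of the norm can be inverted. *)
Lemma haar_hnorm_eq0 n : (haar R n).-negligible [set x | hnorm x = 0].
Proof.
have N0 : (@lebesgue_measure R).-negligible [set 0 : measurableTypeR R].
  by apply/negligibleP => //; exact: lebesgue_measure_set1.
apply: negligibleS (tuple_measure_null_tnth (n := (n + n).+1) ord_max N0).
by move=> x /= /hnorm_eq0_vcoord.
Qed.

Lemma hnorm_lt1 n (x : heis R n) : (hnorm x < 1) =
  ((\sum_(i < n + n) hcoord x i ^+ 2) ^+ 2 + vcoord x ^+ 2 < 1).
Proof.
have S0 : 0 <= (\sum_(i < n + n) hcoord x i ^+ 2) ^+ 2 + vcoord x ^+ 2.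
  by rewrite addr_ge0// sqr_ge0.
rewrite -(@expr_lt1 _ 4%N _ _ (hnorm_ge0 x))// /hnorm -(powR_mulrn 4) ?powR_ge0//.
by rewrite -powRrM mulVf ?powRr1.
Qed.

Lemma measurable_heis_box n (r : R) :
  measurable [set y : heis R n | forall i, `|tnth y i| <= r].
Proof.
rewrite (_ : [set y | _] = \bigcap_(i in [set: 'I_(n + n).+1])
    ((fun y : heis R n => tnth y i) @^-1` `[- r, r])); last first.
  apply/seteqP; split => y /= yr i; have := yr i;
    by rewrite /= in_itv/= ler_norml => // ->.
apply: fin_bigcap_measurable => // i _.
rewrite -[X in measurable X]setTI.
exact: (@measurable_tnth _ (measurableTypeR R)).
Qed.

Lemma haar_heis_box n (r : R) : 0 < r ->
  haar R n [set y | forall i, (`|tnth y i| <= r)%R] =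
  ((r *+ 2) ^+ (n + n).+1)%:E.
Proof.
move=> r0.
rewrite (_ : [set y | _] = [set y : heis R n | forall i,
    (`[- r, r]%classic : set R) (tnth y i)]); last first.
  by apply/seteqP; split => y /= yr i; have := yr i; rewrite /= in_itv/= ler_norml.
rewrite /haar (@tuple_measure_box _ (measurableTypeR R) R (@lebesgue_measure R) _
  (fun=> (`[- r, r]%classic : set R)))//.
rewrite (eq_bigr (fun=> (r *+ 2)%:E)) => [|i _].
  by rewrite prodEFin prodr_const card_ord.
apply: etrans (lebesgue_measure_itv `[- r, r]) _.
by rewrite /= lte_fin gtrN// -EFinD opprK mulr2n.
Qed.

(** The unit ball lies in the cube of half-side 1, since each squared coordinate is below 1. *)
Lemma haar_ball_lty n : (haar R n [set y | (hnorm y < 1)%R] < +oo)%E.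
Proof.
apply: le_lt_trans (ltry ((1 *+ 2) ^+ (n + n).+1 : R)).
rewrite -haar_heis_box//; apply: le_measure.
- by rewrite inE; exact: measurable_hball.
- by rewrite inE; exact: measurable_heis_box.
move=> y /=; rewrite hnorm_lt1 => y1 i.
have S0 : 0 <= \sum_(i < n + n) hcoord y i ^+ 2.
  by rewrite sumr_ge0// => j _; exact: sqr_ge0.
have S1 : \sum_(i < n + n) hcoord y i ^+ 2 < 1.
  rewrite -(@expr_lt1 _ 2%N)//; apply: le_lt_trans y1.
  by rewrite lerDl sqr_ge0.
rewrite -(@expr_le1 _ 2%N)// real_normK ?num_real//; apply: ltW.
case: (unliftP ord_max i) => [j ->|->]; last first.
  by apply: le_lt_trans y1; rewrite lerDr sqr_ge0.
apply: le_lt_trans S1; rewrite (bigD1 j)//= lerDl sumr_ge0// => k _.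
exact: sqr_ge0.
Qed.

Lemma haar_ball_gt0 n : (0 < haar R n [set y | (hnorm y < 1)%R])%E.
Proof.
(* Half-side of a cube inside the ball: both [(n + n) * e] and [e] are at most 1/2, so the
   horizontal sum of squares is at most 1/2 and the central square at most 1/4. *)
pose e : R := (2 * (n + n).+1%:R)^-1.
have e0 : 0 < e by rewrite invr_gt0 mulr_gt0.
apply: (@lt_le_trans _ _ (haar R n [set y | forall i, (`|tnth y i| <= e)%R])).
  by rewrite haar_heis_box// lte_fin exprn_gt0// mulrn_wgt0.
apply: le_measure.
- by rewrite inE; exact: measurable_heis_box.
- by rewrite inE; exact: measurable_hball.
move=> y /= ye; rewrite hnorm_lt1.
have ye2 i : tnth y i ^+ 2 <= e ^+ 2.
  by rewrite -real_normK ?num_real// lerXn2r// nnegrE ltW.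
have Ne : (n + n)%:R * e <= 2^-1.
  rewrite /e invfM mulrCA ler_piMr// ler_pdivrMr// mul1r.
  by rewrite ler_nat.
have e1 : e <= 2^-1.
  by rewrite /e invfM ler_piMr// invf_le1// ler1n.
have S2 : \sum_(i < n + n) hcoord y i ^+ 2 <= 2^-1.
  apply: (@le_trans _ _ (\sum_(i < n + n) e ^+ 2)).
    by apply: ler_sum => i _; exact: ye2.
  rewrite sumr_const card_ord -[leLHS]mulr_natl (expr2 e) mulrA; nra.
have S0 : 0 <= \sum_(i < n + n) hcoord y i ^+ 2.
  by rewrite sumr_ge0// => j _; exact: sqr_ge0.
have v2 : vcoord y ^+ 2 <= e ^+ 2 by exact: ye2.
rewrite expr2; move: S2 S0 v2 e1 e0; rewrite expr2 (expr2 e); nra.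
Qed.

(** Finiteness matters as much as positivity here, because [fine] sends [+oo] to 0. *)
Lemma hball_vol_gt0 n : 0 < hball_vol R n.
Proof. by apply: fine_gt0; rewrite haar_ball_gt0 haar_ball_lty. Qed.

(** Over a space of measure 0 every essential supremum would be [-oo]; this positivity gives lower
    bounds on essential suprema and their values on constants. *)
Lemma haarT_gt0 n : (0 < haar R n setT)%E.
Proof.
apply: lt_le_trans (haar_ball_gt0 n) _.
by apply: le_measure => //; rewrite inE//; exact: measurable_hball.
Qed.

End heisenberg_theory.

(** * Measurability of the Hardy operator, scaling of the weight, almost everywhere domination *)

Section hardy_theory.
Variable R : realType.

Lemma measurable_hardy m n (f : 'I_m -> heis R n -> R) :
  (forall i, measurable_fun setT (f i)) -> measurable_fun setT (hardy f).
Proof.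
move=> mf; apply: measurable_funM.
  (* The inverse becomes a power with exponent -1; the two agree at 0 as well, where both are 0. *)
  rewrite (_ : (fun x => _) = fun x : heis R n =>
      (hball_vol R n ^+ m * hnorm x ^+ (m * hdim n)) `^ (-1)); last first.
    apply/funext => x; rewrite powR_inv1// mulr_ge0// exprn_ge0// ?hnorm_ge0//.
    exact/ltW/hball_vol_gt0.
  apply: (measurableT_comp (measurable_powR _)).
  apply: measurable_funM => //; apply: measurable_funX; exact: measurable_hnorm.
(* The domain of integration moves with [x]; it is the section at [x] of the fixed measurable set
   [D], so Tonelli applies to the integrand extended by 0. *)
pose D := [set p : heis R n * mheis R m n | mhnorm p.2 < hnorm p.1].
have mD : measurable D.
  rewrite -[X in measurable X]setTI.
  apply: (measurable_fun_ltr (f := fun p : heis R n * mheis R m n => mhnorm p.2)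
    (g := fun p => hnorm p.1) _ _ _ (Y := [set true])) => //.
  - by apply: (measurableT_comp (@measurable_mhnorm R m n)).
  - by apply: (measurableT_comp (@measurable_hnorm R n)).
pose F (p : heis R n * mheis R m n) := (EFin \o tensor f \o snd) \_ D p.
have mF : measurable_fun setT F.
  apply/(measurable_restrictT _ mD); apply: measurable_funTS.
  apply: measurableT_comp => //; apply/measurable_EFinP; exact: measurable_tensor.
(* The integrand is signed, so Tonelli is applied to its positive and negative parts separately. *)
rewrite (_ : (fun x => _) = fun x => fine (\int[mhaar R m n]_y F^\+ (x, y) -
   \int[mhaar R m n]_y F^\- (x, y))%E); last first.
  apply/funext => x; rewrite /Rintegral integral_mkcond integralE.
  have FE y : ((EFin \o tensor f) \_ [set y | mhnorm y < hnorm x]) y = F (x, y).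
    by rewrite /F /patch !mem_setE.
  congr (fine (_ - _))%E; apply: eq_integral => y _.
  - by rewrite !funeposE FE.
  - by rewrite !funenegE FE.
apply: measurableT_comp; first exact: fine_measurable.
apply: emeasurable_funB.
- apply: (measurable_fun_fubini_tonelli_F (m2 := mhaar R m n) (F^\+)%E) => //.
  exact: measurable_funepos.
- apply: (measurable_fun_fubini_tonelli_F (m2 := mhaar R m n) (F^\-)%E) => //.
  exact: measurable_funeneg.
Qed.

Lemma powR_sum (I : Type) (s : seq I) (r : R) (c : I -> R) : r != 0 ->
  r `^ (\sum_(i <- s) c i) = \prod_(i <- s) r `^ c i.
Proof.
move=> r0; apply: (big_morph (powR r)); last exact: powRr0.
by move=> x y; rewrite powRD// r0 implybT.
Qed.

Lemma integral_mball_tensor m n (al : 'I_m -> R) (r : R) : 0 < r ->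
  let W : mheis R m n -> R := tensor (fun i x => hnorm x `^ (- al i)) in
  (\int[mhaar R m n]_(y in [set y | (mhnorm y < r)%R]) (W y)%:E =
   (r ^+ (m * hdim n) * r `^ (- \sum_(i < m) al i))%:E *
   \int[mhaar R m n]_(y in [set y | (mhnorm y < 1)%R]) (W y)%:E)%E.
Proof.
move=> r0 W.
have mW : measurable_fun setT W.
  apply: measurable_tensor => i.
  by apply: (measurableT_comp (measurable_powR _)); exact: measurable_hnorm.
have W0 y : 0 <= W y by apply: prodr_ge0 => i _; exact: powR_ge0.
(* The weight is extended by 0 outside the ball, because [dilates] concerns integrals over the whole
   space. *)
pose F := (EFin \o W) \_ [set y : mheis R m n | mhnorm y < r].
have mF : measurable_fun setT F.
  apply/(measurable_restrictT _ (measurable_mball r)); apply: measurable_funTS.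
  exact/measurable_EFinP.
have F0 y : (0 <= F y)%E by apply: erestrict_ge0 => ? _; rewrite lee_fin.
have WM y : W (mheis_dil r y) = r `^ (- \sum_(i < m) al i) * W y.
  rewrite -sumrN powR_sum ?gt_eqF// -big_split/=; apply: eq_bigr => i _.
  by rewrite tnth_mktuple hnorm_dil ?ltW// powRM ?hnorm_ge0 ?ltW.
have E1 : (\int[mhaar R m n]_y F (mheis_dil r y) = (r `^ (- \sum_(i < m) al i))%:E *
   \int[mhaar R m n]_(y in [set y | (mhnorm y < 1)%R]) (W y)%:E)%E.
  rewrite -ge0_integralZl//; last 4 first.
  - exact: measurable_mball.
  - by apply: measurable_funTS; exact/measurable_EFinP.
  - by move=> y _; rewrite lee_fin.
  - by rewrite lee_fin powR_ge0.
  rewrite [RHS]integral_mkcond; apply: eq_integral => y _.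
  have ballE : (mheis_dil r y \in [set y | mhnorm y < r]) =
      (y \in [set y | mhnorm y < 1]).
    have dE : (mhnorm (mheis_dil r y) < r) = (mhnorm y < 1).
      by rewrite mhnorm_dil ?ltW// -[X in _ < X]mulr1 ltr_pM2l.
    by apply/idP/idP; rewrite !inE/= dE.
  rewrite /F /patch ballE; case: ifP => // _ /=.
  by rewrite WM EFinM.
(* The integral of [F] after dilation is computed twice: by homogeneity of the weight ([E1]) and by
   the Jacobian. Multiplying by [r ^+ (m * hdim n)] isolates the integral of [F]. *)
have := etrans (esym E1) (mhaar_dilates r0 mF F0).
move=> E; rewrite EFinM -muleA E muleA -EFinM mulfV ?mul1e; last first.
  by rewrite expf_neq0// gt_eqF.
by rewrite [LHS]integral_mkcond.
Qed.

Lemma Hinfty_norm_ge0 n (a : R) (f : heis R n -> R) : (0 <= Hinfty_norm a f)%E.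
Proof.
apply: ess_sup_gee; first exact: haarT_gt0.
by apply: aeW => x; rewrite lee_fin mulr_ge0// powR_ge0.
Qed.

(** The essential supremum is itself an almost everywhere bound, and dividing by the power of the
    norm is legitimate off the null set where the norm vanishes. *)
Lemma Hinfty_ae n (a : R) (f : heis R n -> R) : Hinfty a f ->
  {ae haar R n, forall x, `|f x| <= fine (Hinfty_norm a f) * hnorm x `^ (- a)}.
Proof.
move=> [mf foo].
have [N NE] : exists N : R, Hinfty_norm a f = N%:E.
  by exists (fine (Hinfty_norm a f)); rewrite fineK// ge0_fin_numE// Hinfty_norm_ge0.
have N0 : {ae haar R n, forall x, hnorm x != 0}.
  apply: negligibleS (haar_hnorm_eq0 R n) => x /= /negP.
  by rewrite negbK => /eqP.
have fN : {ae haar R n, forall x, ((hnorm x `^ a * `|f x|)%:E <= N%:E)%E}.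
  by rewrite -NE; exact: ess_sup_ge.
apply: filterS2 N0 fN => x x0; rewrite NE lee_fin /= powRN => h.
rewrite ler_pdivlMr 1?mulrC//.
by rewrite powR_gt0// lt_neqAle eq_sym x0 hnorm_ge0.
Qed.

(** Each factor's exceptional set lifts to a null cylinder, and finitely many of these form a null
    set; elsewhere the bounds multiply. *)
Lemma tensor_ae m n (al N : 'I_m -> R) (f : 'I_m -> heis R n -> R) :
  (forall i, {ae haar R n, forall x, `|f i x| <= N i * hnorm x `^ (- al i)}) ->
  {ae mhaar R m n, forall y, `|tensor f y| <=
    \prod_(i < m) N i * tensor (fun i x => hnorm x `^ (- al i)) y}.
Proof.
move=> fN.
have : {ae mhaar R m n, forall y, forall i, `|f i (tnth y i)| <=
    N i * hnorm (tnth y i) `^ (- al i)}.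
  apply: filter_forall => i.
  exact: negligibleS (tuple_measure_null_tnth (n := m) i (fN i)).
apply: filterS => y h; rewrite /tensor normr_prod -big_split/=.
by apply: ler_prod => i _; rewrite normr_ge0 h.
Qed.

End hardy_theory.

(** * The upper bound, and the power functions that attain it *)

Section hardy_bound.
Variables (R : realType) (n m : nat) (al : 'I_m -> R).

Let a := \sum_(i < m) al i.
Let W : mheis R m n -> R := tensor (fun i x => hnorm x `^ (- al i)).
Let I := (\int[mhaar R m n]_(y in [set y | (mhnorm y < 1)%R]) (W y)%:E)%E.

Let I_ge0 : (0 <= I)%E.
Proof.
apply: integral_ge0 => y _; rewrite lee_fin; apply: prodr_ge0 => i _.
exact: powR_ge0.
Qed.

Let measurable_W : measurable_fun setT W.
Proof.
apply: measurable_tensor => i.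
by apply: (measurableT_comp (measurable_powR _)); exact: measurable_hnorm.
Qed.

Let W_ge0 y : 0 <= W y.
Proof. by apply: prodr_ge0 => i _; exact: powR_ge0. Qed.

(** This single estimate of the integral of the absolute value yields both absolute convergence and
    the norm bound. *)
Lemma integral_tensor_le (f : 'I_m -> heis R n -> R) (r : R) :
  (forall i, Hinfty (al i) (f i)) -> 0 < r ->
  (\int[mhaar R m n]_(y in [set y | (mhnorm y < r)%R]) `|(tensor f y)%:E| <=
   (\prod_(i < m) fine (Hinfty_norm (al i) (f i)))%:E *
   ((r ^+ (m * hdim n) * r `^ (- a))%:E * I))%E.
Proof.
move=> Hf r0.
have N0 : 0 <= \prod_(i < m) fine (Hinfty_norm (al i) (f i)).
  by apply: prodr_ge0 => i _; rewrite fine_ge0// Hinfty_norm_ge0.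
rewrite -integral_mball_tensor// -ge0_integralZl//; last 3 first.
- exact: measurable_mball.
- by apply: measurable_funTS; exact/measurable_EFinP.
- by move=> y _; rewrite lee_fin.
apply: ae_ge0_le_integral => //.
- exact: measurable_mball.
- apply: measurable_funTS; apply: measurableT_comp => //; apply/measurable_EFinP.
  by apply: measurable_tensor => i; case: (Hf i).
- by move=> y _; rewrite -EFinM lee_fin mulr_ge0.
- apply: measurable_funTS; apply: emeasurable_funM => //.
  exact/measurable_EFinP.
- have := tensor_ae (fun i => Hinfty_ae (Hf i)).
  by apply: filterS => y h _; rewrite /= lee_fin.
Qed.

Hypothesis I_lty : (I < +oo)%E.

Lemma hardy_cvT (f : 'I_m -> heis R n -> R) (x : heis R n) :
  (forall i, Hinfty (al i) (f i)) -> hardy_cv f x.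
Proof.
move=> Hf; rewrite /hardy_cv.
(* When the norm of [x] is 0, the ball is empty because [mhnorm] is nonnegative. *)
have [x0|x0] := leP (hnorm x) 0.
  rewrite (_ : [set y | _] = set0); first exact: integrable_set0.
  apply/seteqP; split => y //= /lt_le_trans/(_ x0).
  by rewrite ltNge sqrtr_ge0.
apply/integrableP; split.
  apply: measurable_funTS; apply/measurable_EFinP.
  by apply: measurable_tensor => i; case: (Hf i).
apply: le_lt_trans (integral_tensor_le Hf x0) _.
by rewrite -(fineK (_ : I \is a fin_num)) ?ge0_fin_numE// -!EFinM ltry.
Qed.

Lemma hardy_le (f : 'I_m -> heis R n -> R) (x : heis R n) :
  (forall i, Hinfty (al i) (f i)) ->
  hnorm x `^ a * `|hardy f x| <= (hball_vol R n ^+ m)^-1 * fine I *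
    \prod_(i < m) fine (Hinfty_norm (al i) (f i)).
Proof.
move=> Hf.
have N0 : 0 <= \prod_(i < m) fine (Hinfty_norm (al i) (f i)).
  by apply: prodr_ge0 => i _; rewrite fine_ge0// Hinfty_norm_ge0.
have V0 : 0 <= (hball_vol R n ^+ m)^-1.
  by rewrite invr_ge0 exprn_ge0// ltW// hball_vol_gt0.
have [x0|x0] := leP (hnorm x) 0.
  rewrite /hardy (_ : [set y | _] = set0); last first.
    apply/seteqP; split => y //= /lt_le_trans/(_ x0).
    by rewrite ltNge sqrtr_ge0.
  by rewrite Rintegral_set0 !mulr0 normr0 mulr0 !mulr_ge0// fine_ge0.
rewrite /hardy normrM.
set r := hnorm x.
set J := Rintegral _ _ _.
have J_le : `|J| <= \prod_(i < m) fine (Hinfty_norm (al i) (f i)) *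
    (r ^+ (m * hdim n) * r `^ (- a) * fine I).
  rewrite -lee_fin !EFinM fineK ?ge0_fin_numE// -EFinM.
  apply: le_trans (integral_tensor_le Hf x0).
  rewrite EFin_normr_Rintegral; last 2 first.
  - exact: measurable_mball.
  - exact: hardy_cvT.
  apply: le_abse_integral; first exact: measurable_mball.
  apply: measurable_funTS; apply/measurable_EFinP.
  by apply: measurable_tensor => i; case: (Hf i).
rewrite ger0_norm; last first.
  by rewrite invr_ge0 mulr_ge0// exprn_ge0// ltW// hball_vol_gt0.
rewrite mulrCA invfM -!mulrA; apply: ler_wpM2l => //.
apply: (@le_trans _ _ ((r ^+ (m * hdim n))^-1 * (r `^ a * 
  (\prod_(i < m) fine (Hinfty_norm (al i) (f i)) *
    (r ^+ (m * hdim n) * r `^ (- a) * fine I))))).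
  rewrite ler_wpM2l ?invr_ge0 ?exprn_ge0 ?(ltW x0)// ler_wpM2l ?powR_ge0//.
have rQ : r ^+ (m * hdim n) != 0 by rewrite expf_neq0// gt_eqF.
have ra : r `^ a != 0 by rewrite gt_eqF// powR_gt0.
(* With [J] replaced by its bound, all powers of [r] cancel and the two sides are equal. *)
by rewrite powRN le_eqVlt; apply/orP; left; apply/eqP; field; rewrite rQ ra.
Qed.

Lemma Hinfty_bound_hardy : Hinfty_bound al a (@hardy_cv R m n) (@hardy R m n)
  ((hball_vol R n ^+ m)^-1 * fine I).
Proof.
move=> f Hf; split.
- by apply: aeW => x; exact: hardy_cvT.
- by apply: measurable_hardy => i; case: (Hf i).
- rewrite (eq_bigr (fun i => (fine (Hinfty_norm (al i) (f i)))%:E)); last first.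
    move=> i _; rewrite fineK// ge0_fin_numE ?Hinfty_norm_ge0//.
    by case: (Hf i).
  rewrite prodEFin -EFinM; apply/ess_supP; apply: aeW => x.
  by rewrite lee_fin; exact: hardy_le.
Qed.

Let w (i : 'I_m) (x : heis R n) : R := hnorm x `^ (- al i).

(** The weighted function is identically 1 off a null set, so these powers are normalized test
    functions. *)
Lemma Hinfty_norm_w i : Hinfty_norm (al i) (w i) = 1%E.
Proof.
apply: ess_sup_ae_cst; first exact: haarT_gt0.
apply: negligibleS (haar_hnorm_eq0 R n) => x /= h.
apply: contrapT => /eqP x0; apply: h.
rewrite /w ger0_norm ?powR_ge0// powRN mulfV//.
by rewrite powR_eq0 negb_and x0.
Qed.

(** By scaling, [hardy w] is a constant multiple of the norm to the power [- a] off a null set; that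
    constant is the essential supremum. *)
Lemma Hinfty_norm_hardy_w :
  Hinfty_norm a (hardy w) = ((hball_vol R n ^+ m)^-1 * fine I)%:E.
Proof.
apply: ess_sup_ae_cst; first exact: haarT_gt0.
apply: negligibleS (haar_hnorm_eq0 R n) => x /= h.
apply: contrapT => /eqP x0; apply: h; congr EFin.
have r0 : 0 < hnorm x by rewrite lt_neqAle eq_sym x0 hnorm_ge0.
rewrite /hardy /Rintegral integral_mball_tensor// -/W -/I -/a.
rewrite -[I]fineK ?ge0_fin_numE// -EFinM/= ger0_norm; last first.
  rewrite !mulr_ge0 ?invr_ge0 ?exprn_ge0 ?powR_ge0 ?fine_ge0 ?mulr_ge0
    ?exprn_ge0 ?hnorm_ge0//.
  exact/ltW/hball_vol_gt0.
have rQ : hnorm x ^+ (m * hdim n) != 0 by rewrite expf_neq0.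
have ra : hnorm x `^ a != 0 by rewrite gt_eqF// powR_gt0.
have Vm : hball_vol R n ^+ m != 0 by rewrite expf_neq0// gt_eqF// hball_vol_gt0.
by rewrite powRN; field; rewrite rQ ra Vm.
Qed.

End hardy_bound.

(** * The operator norm as an infimum of admissible constants *)

Theorem theorem3 (R : realType) (n m : nat) (n_ge1 : (1 <= n)%N)
    (m_ge1 : (1 <= m)%N) (al : 'I_m -> R) (al_gt0 : forall i, 0 < al i) :
  let a := \sum_(i < m) al i in
  (hardy_const n al < +oo)%E ->
  Hinfty_bounded al a (@hardy_cv R m n) (@hardy R m n) /\
  Hinfty_opnorm al a (@hardy_cv R m n) (@hardy R m n) = hardy_const n al.
Proof.
move=> a; rewrite /hardy_const; set I := integral _ _ _ => constoo.
have V0 : 0 < (hball_vol R n ^+ m)^-1.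
  by rewrite invr_gt0 exprn_gt0// hball_vol_gt0.
have I0 : (0 <= I)%E.
  by apply: integral_ge0 => y _; rewrite lee_fin prodr_ge0// => i _; exact: powR_ge0.
(* Finiteness passes from the normalized constant to [I] because the factor in front is strictly
   positive. *)
have Ioo : (I < +oo)%E.
  rewrite ltey; apply: contra_ltN constoo => /eqP ->.
  by rewrite gt0_muley// lte_fin.
have Ifin : I = (fine I)%:E by rewrite fineK// ge0_fin_numE.
have HC := Hinfty_bound_hardy Ioo.
split; first by eexists; exact: HC.
rewrite /Hinfty_opnorm Ifin -EFinM; apply/eqP; rewrite eq_le; apply/andP; split.
  by apply: ereal_inf_lbound; exists ((hball_vol R n ^+ m)^-1 * fine I).
(* Any admissible [C] is tested on the powers of the norm: the product of their norms is 1, so [C]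
   is at least the norm of their image. *)
apply: le_ereal_inf_tmp => _ [C HCb <-].
have := HCb (fun i x => hnorm x `^ (- al i)).
case=> [i|_ _].
  split; last by rewrite Hinfty_norm_w ltry.
  by apply: (measurableT_comp (measurable_powR _)); exact: measurable_hnorm.
rewrite (Hinfty_norm_hardy_w Ioo) big1 ?mule1// => i _.
exact: Hinfty_norm_w.
Qed.
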